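(* Let $(\mathbf{C},I)$ be an effectus where the scalars $\mathbf{C}(I,I)$ are isomorphic to $\{0\}$. Then $\mathbf{C}$ is equivalent to the trivial category with a single object and a single morphism.
   Context: A partial commutative monoid (PCM) is a set $X$ with $0\in X$ and a partial binary operation $\oplus$ with $(x\oplus y)\oplus z=x\oplus(y\oplus z)$, $x\oplus y=y\oplus x$, $0\oplus x=x$, where ''$=$'' is Kleene equality (if either side is defined, so is the other, and they are equal); $x\perp y$ (also: $x,y$ are summable) means $x\oplus y$ is defined. A map $f$ of PCMs is additive if $f(0)=0$ and $x\perp y$ implies $f(x)\oplus f(y)=f(x\oplus y)$ (in particular defined); biadditive means additive in each argument. An effect algebra is a PCM $E$ with an element $1\in E$ such that for each $a\in E$ there is a unique $a^{\perp}\in E$ with $a\oplus a^{\perp}=1$, and $a\perp1$ implies $a=0$. A finPAC (finitely partially additive category) is a category $\mathbf{C}$ with finite coproducts (coprojections $\kappa_i$), all of whose homsets are PCMs with biadditive composition (so there are zero morphisms $0_{AB}$), such that: (compatible sum) any compatible pair $f,g\colon A\to B$ is summable in $\mathbf{C}(A,B)$, where compatible means there is $h\colon A\to B+B$ with $\triangleright_1\circ h=f$ and $\triangleright_2\circ h=g$, the partial projections $\triangleright_i\colon B+B\to B$ being determined by $\triangleright_i\circ\kappa_i=\mathrm{id}$ and $\triangleright_i\circ\kappa_k=0$ for $k\neq i$; (untying) if $f,g\colon A\to B$ are summable then so are $\kappa_1\circ f,\kappa_2\circ g\colon A\to B+B$. An effectus (in partial form) is a finPAC $\mathbf{C}$ with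 a distinguished object $I$ such that: (i) for each $A$ the PCM $\mathbf{C}(A,I)$ is an effect algebra, with top written $\mathbf{1}_A$; (ii) $\mathbf{1}_B\circ f=0_{AI}$ implies $f=0_{AB}$ for all $f\colon A\to B$; (iii) $\mathbf{1}_B\circ f\perp\mathbf{1}_B\circ g$ implies $f\perp g$ for all $f,g\colon A\to B$. The scalars are the morphisms $I\to I$; $\mathbf{C}(I,I)\cong\{0\}$ means there is exactly one scalar. *)

(* Defs.v *)
From mathcomp Require Import ssreflect ssrfun ssrbool.

Set Implicit Arguments.
Unset Strict Implicit.
Unset Printing Implicit Defensive.

Declare Scope effectus_scope.
Delimit Scope effectus_scope with eff.
Local Open Scope effectus_scope.

(* [None] encodes "undefined", so equality in [option X] is Kleene equality. *)
Record pcm (X : Type) := Pcm {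
  pzero : X;
  oplus : X -> X -> option X;
  oplusA : forall x y z : X,
    obind (fun s => oplus s z) (oplus x y) =
    obind (fun t => oplus x t) (oplus y z);
  oplusC : forall x y : X, oplus x y = oplus y x;
  oplus0 : forall x : X, oplus pzero x = Some x
}.

Definition summable (X : Type) (M : pcm X) (x y : X) : Prop :=
  exists z : X, oplus M x y = Some z.

Definition additive (X Y : Type) (M : pcm X) (N : pcm Y) (f : X -> Y) : Prop :=
  f (pzero M) = pzero N /\
  forall x y z : X, oplus M x y = Some z -> oplus N (f x) (f y) = Some (f z).

Definition biadditive (X Y Z : Type) (M : pcm X) (N : pcm Y) (P : pcm Z)
    (f : X -> Y -> Z) : Prop :=
  (forall y : Y, additive M P (fun x => f x y)) /\
  (forall x : X, additive N P (f x)).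

Definition is_effect_algebra (X : Type) (M : pcm X) (one : X) : Prop :=
  (forall a : X, exists! b : X, oplus M a b = Some one) /\
  (forall a : X, summable M a one -> a = pzero M).

Record category := Category {
  obj :> Type;
  hom : obj -> obj -> Type;
  idm : forall A : obj, hom A A;
  comp : forall A B D : obj, hom B D -> hom A B -> hom A D;
  comp_idl : forall (A B : obj) (f : hom A B), comp (idm B) f = f;
  comp_idr : forall (A B : obj) (f : hom A B), comp f (idm A) = f;
  compA : forall (A B D E : obj) (h : hom D E) (g : hom B D) (f : hom A B),
    comp h (comp g f) = comp (comp h g) f
}.
Arguments hom {C} : rename.
Arguments idm {C} : rename.
Arguments comp {C A B D} : rename.

Notation "g ∘ f" := (comp g f)
  (at level 40, left associativity) : effectus_scope.

Definition trivial_category : category :=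
  @Category unit (fun _ _ => unit) (fun _ => tt) (fun _ _ _ _ _ => tt)
    (fun _ _ f => match f with tt => erefl end)
    (fun _ _ f => match f with tt => erefl end)
    (fun _ _ _ _ _ _ _ => erefl).

Record functor (C D : category) := Functor {
  fobj :> C -> D;
  fmap : forall A B : C, hom A B -> hom (fobj A) (fobj B);
  fmap_id : forall A : C, fmap (idm A) = idm (fobj A);
  fmap_comp : forall (A B E : C) (g : hom B E) (f : hom A B),
    fmap (g ∘ f) = fmap g ∘ fmap f
}.

Definition functor_id (C : category) : functor C C :=
  @Functor C C (fun A => A) (fun _ _ f => f)
    (fun _ => erefl) (fun _ _ _ _ _ => erefl).

Definition functor_comp (C D E : category) (G : functor D E) (F : functor C D) :
    functor C E :=
  @Functor C E (fun A => G (F A)) (fun _ _ f => fmap G (fmap F f))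
    (fun A => etrans (f_equal (fun k => fmap G k) (fmap_id F A)) (fmap_id G (F A)))
    (fun _ _ _ g f => etrans (f_equal (fun k => fmap G k) (fmap_comp F g f))
                             (fmap_comp G (fmap F g) (fmap F f))).

Definition is_iso (C : category) (A B : C) (f : hom A B) : Prop :=
  exists g : hom B A, g ∘ f = idm A /\ f ∘ g = idm B.

Definition naturally_isomorphic (C D : category) (F G : functor C D) : Prop :=
  exists eta : forall A : C, hom (F A) (G A),
    (forall (A B : C) (f : hom A B), eta B ∘ fmap F f = fmap G f ∘ eta A) /\
    (forall A : C, is_iso (eta A)).

Definition equivalent_categories (C D : category) : Prop :=
  exists (F : functor C D) (G : functor D C),
    naturally_isomorphic (functor_comp G F) (functor_id C) /\
    naturally_isomorphic (functor_comp F G) (functor_id D).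

(* Finite coproducts are chosen data, given by the nullary and binary cases;
   n-ary ones are obtained by iteration. *)
Record finite_coproducts (C : category) := FiniteCoproducts {
  initial : C;
  initial_map : forall A : C, hom initial A;
  initial_uniq : forall (A : C) (f : hom initial A), f = initial_map A;
  coprod : C -> C -> C;
  kappa1 : forall A B : C, hom A (coprod A B);
  kappa2 : forall A B : C, hom B (coprod A B);
  cotuple : forall A B D : C, hom A D -> hom B D -> hom (coprod A B) D;
  cotuple1 : forall (A B D : C) (f : hom A D) (g : hom B D),
    cotuple f g ∘ kappa1 A B = f;
  cotuple2 : forall (A B D : C) (f : hom A D) (g : hom B D),
    cotuple f g ∘ kappa2 A B = g;
  cotuple_uniq : forall (A B D : C) (f : hom A D) (g : hom B D)
      (h : hom (coprod A B) D),
    h ∘ kappa1 A B = f -> h ∘ kappa2 A B = g -> h = cotuple f g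
}.

Section PartialProjections.
Variables (C : category) (S : finite_coproducts C).
Variable M : forall A B : C, pcm (hom A B).

Definition pproj1 (B : C) : hom (coprod S B B) B :=
  cotuple S (idm B) (pzero (M B B)).
Definition pproj2 (B : C) : hom (coprod S B B) B :=
  cotuple S (pzero (M B B)) (idm B).

Definition compatible (A B : C) (f g : hom A B) : Prop :=
  exists h : hom A (coprod S B B), pproj1 B ∘ h = f /\ pproj2 B ∘ h = g.

End PartialProjections.

Record finPAC := FinPAC {
  fp_cat :> category;
  fp_coprod : finite_coproducts fp_cat;
  fp_pcm : forall A B : fp_cat, pcm (hom A B);
  fp_comp_biadditive : forall A B D : fp_cat,
    biadditive (fp_pcm B D) (fp_pcm A B) (fp_pcm A D) (@comp fp_cat A B D);
  compatible_sum : forall (A B : fp_cat) (f g : hom A B),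
    compatible fp_coprod fp_pcm f g -> summable (fp_pcm A B) f g;
  untying : forall (A B : fp_cat) (f g : hom A B),
    summable (fp_pcm A B) f g ->
    summable (fp_pcm A (coprod fp_coprod B B))
      (kappa1 fp_coprod B B ∘ f) (kappa2 fp_coprod B B ∘ g)
}.

Record effectus := Effectus {
  eff_finPAC :> finPAC;
  eff_I : eff_finPAC;
  truth : forall A : eff_finPAC, hom A eff_I;
  eff_effect_algebra : forall A : eff_finPAC,
    is_effect_algebra (fp_pcm A eff_I) (truth A);
  truth_zero : forall (A B : eff_finPAC) (f : hom A B),
    truth B ∘ f = pzero (fp_pcm A eff_I) -> f = pzero (fp_pcm A B);
  truth_summable : forall (A B : eff_finPAC) (f g : hom A B),
    summable (fp_pcm A eff_I) (truth B ∘ f) (truth B ∘ g) ->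
    summable (fp_pcm A B) f g
}.

Definition scalar (E : effectus) : Type := hom (eff_I E) (eff_I E).

(* Main.v *)
(* If the only scalar is zero then id_I = 0, so every truth morphism
   1_A = id_I o 1_A is zero. Hence 1_B o f = 0 for every f : A -> B, which forces
   f = 0: each homset is the singleton {0}. *)
From mathcomp Require Import ssreflect ssrfun.
Require Import Defs.

Local Open Scope effectus_scope.

(** Each truth map factors through [idm (eff_I E)], which is zero when there is one scalar, so
    [truth_zero] kills every morphism. With singleton homsets, zero maps make all objects
    isomorphic, and [eff_I E] represents them all. *)

Lemma comp_pzero_l (C : finPAC) (A B D : C) (f : hom A B) :
  pzero (fp_pcm B D) ∘ f = pzero (fp_pcm A D).
Proof. by have [/(_ f) []] := fp_comp_biadditive A B D. Qed.

Lemma hom_pzero (E : effectus) (hscalar : exists! s : scalar E, True)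
    (A B : E) (f : hom A B) : f = pzero (fp_pcm A B).
Proof.
have [s [_ s_uniq]] := hscalar.
have id_pzero : idm (eff_I E) = pzero (fp_pcm _ _).
  by rewrite -(s_uniq (idm _) I) -(s_uniq (pzero _) I).
by apply: truth_zero; rewrite -[truth B]comp_idl id_pzero !comp_pzero_l.
Qed.

Lemma thin_equivalent_trivial (C : category) (X : C) (h : forall A B : C, hom A B)
    (thin : forall (A B : C) (f g : hom A B), f = g) :
  equivalent_categories C trivial_category.
Proof.
pose F := @Functor C trivial_category (fun _ => tt) (fun _ _ _ => tt)
  (fun _ => erefl) (fun _ _ _ _ _ => erefl).
pose G := @Functor trivial_category C (fun _ => X) (fun _ _ _ => idm X)
  (fun _ => erefl) (fun _ _ _ _ _ => thin _ _ _ _).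
exists F, G; split.
(* Thinness gives naturality and the inverse laws for free; only maps in both directions are needed,
   and [h] supplies them. *)
- exists (fun A => h X A); split=> [A B f | A]; first exact: thin.
  by exists (h A X); split; apply: thin.
- exists (fun _ => tt); split=> [[] [] [] | []] //.
  by exists tt.
Qed.

Theorem proposition45 (E : effectus) (hscalar : exists! s : scalar E, True) :
  equivalent_categories E trivial_category.
Proof.
apply: (thin_equivalent_trivial E (eff_I E) (fun A B => pzero (fp_pcm A B))).
by move=> A B f g; rewrite (hom_pzero E hscalar A B f) (hom_pzero E hscalar A B g).
Qed.
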